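(* Let $0<\delta<1/10$ be a real number and let $n$ be an integer with $n>200/\delta^{3/5}$. Let $\mathcal{C}_1$ denote the largest connected component of the random graph $G(n,1/n)$. Then $$\mathbf{P}\Big(|\mathcal{C}_1|<\lfloor \delta n^{2/3}\rfloor\Big)\le 15\,\delta^{3/5}.$$
   Context: The random graph $G(n,p)$ is obtained from the complete graph on $n$ (labelled) vertices by independently retaining each edge with probability $p$ and deleting it with probability $1-p$. $|\mathcal{C}_1|$ is the maximal number of vertices in a connected component. *)

(* Defs.v *)
From HB Require Import structures.
From mathcomp Require Import all_boot all_order all_algebra.
From mathcomp Require Import reals exp.

Set Implicit Arguments.
Unset Strict Implicit.
Unset Printing Implicit Defensive.

Import Order.TTheory GRing.Theory Num.Theory.

Local Open Scope ring_scope.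

(* Edges of the complete graph on 'I_n, as two-element sets of vertices. *)
Definition edge (n : nat) := {e : {set 'I_n} | #|e| == 2%N}.

(* A simple graph on the vertex set 'I_n is identified with its edge set. *)
Definition graph (n : nat) := {set edge n}.

Definition adj (n : nat) (G : graph n) : rel 'I_n :=
  fun x y => [exists e in G, val e == [set x; y]].

Definition component (n : nat) (G : graph n) (x : 'I_n) : {set 'I_n} :=
  [set y | connect (adj G) x y].

Definition components (n : nat) (G : graph n) : {set {set 'I_n}} :=
  [set component G x | x : 'I_n].

Definition largest_component_size (n : nat) (G : graph n) : nat :=
  \max_(C in components G) #|C|.

(* The law of G(n,p): edges are kept independently with probability p, so the
   probability of a graph is a product over all edges of the complete graph. *)
Definition Gnp (R : realType) (n : nat) (p : R) (G : graph n) : R :=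
  \prod_(e : edge n) (if e \in G then p else 1 - p).

Definition Gnp_prob (R : realType) (n : nat) (p : R) (A : pred (graph n)) : R :=
  \sum_(G : graph n | A G) Gnp p G.

Lemma Gnp_prob_total (R : realType) (n : nat) (p : R) :
  Gnp_prob p (fun _ : graph n => true) = 1.
Proof.
rewrite /Gnp_prob /Gnp -(bigA_distr _ _ (fun=> p) (fun=> 1 - p)).
by rewrite big1 // => e _ /=; rewrite addrCA subrr addr0.
Qed.

(* Main.v *)
Require Import Defs.
From mathcomp Require Import all_boot all_order all_algebra.
From mathcomp Require Import reals exp.
From mathcomp Require Import ring lra zify.

Set Implicit Arguments.
Unset Strict Implicit.
Unset Printing Implicit Defensive.

Import Order.TTheory GRing.Theory Num.Theory.

Local Open Scope ring_scope.

(** Let k be the integer part of delta n^(2/3) and let X be the number of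
    connected components of G(n, 1/n) with between k and 2k vertices.  If the
    largest component has fewer than k vertices then X = 0, so it is enough to
    show that X is rarely 0, and the second moment method does this.

    Correlations.  With q = 1 - p, and c_s the probability that G(s, p) is
    connected, a given s-set is a component with probability c_s q^(s (n - s)).
    Two disjoint sets of sizes s and t are both components with probability
    c_s c_t q^(s (n - s) + t (n - s - t)), and given the first set there are
    C(n - s, t) choices of the second, instead of C(n, t).  Bernoulli's
    inequality gives C(n - s, t) <= C(n, t) q^(s t) when n p <= 1 [binD_le], so
    that E[X (X - 1)] <= (E X)^2, and Chebyshev's inequality becomes
    P(X = 0) <= 1 / E X [no_component_bound].

    The mean.  Exploring a set of s vertices one vertex at a time expresses c_s
    by a recursion [expect_reaches] to which Cayley's count of trees gives a lower
    solution: c_s >= s^(s - 2) p^(s - 1) q^C(s, 2) [conn_prob_ge].  For p = 1/n,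
    the falling factorial in C(n, s) is at least n^s q^C(s, 2) (1 - s^3/n^2)
    [ffact_ge], and all powers of q combine into r^s with r = q^(n - 1), which is
    about 1/e.  A form of Stirling's bound in which r replaces 1/e
    [fact_sqr_le] then makes the expected number of components of size s
    at least a constant times n s^(-5/2), as long as s^3 is small compared to n^2
    [mean_comp_ge].  Summing over k <= s <= 2k, E X is at least a constant times
    n k^(-3/2), that is, delta^(-3/2).

    The outcome is P(X = 0) <= C delta^(3/2), with C small enough for this to be
    below 15 delta^(3/5) when delta < 1/10. *)

(** * Random subsets of a finite set *)

(** Each element of E is kept independently with probability p, so that for
    E := edge n this is the expectation over G(n, p). *)
Definition expect (R : comNzRingType) (E : finType) (p : R)
    (f : {set E} -> R) : R :=
  \sum_(G : {set E}) (\prod_e (if e \in G then p else 1 - p)) * f G.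

Definition depends_on (T : Type) (E : finType) (D : {set E})
    (f : {set E} -> T) : Prop :=
  forall G, f (G :&: D) = f G.

Lemma eq_expect (R : comNzRingType) (E : finType) (p : R)
    (f g : {set E} -> R) :
  f =1 g -> expect p f = expect p g.
Proof. by move=> fg; apply: eq_bigr => G _; rewrite fg. Qed.

Lemma expect_sum (R : comNzRingType) (E I : finType) (p : R) (P : pred I)
    (f : I -> {set E} -> R) :
  expect p (fun G => \sum_(i | P i) f i G) = \sum_(i | P i) expect p (f i).
Proof.
rewrite /expect exchange_big /=; apply: eq_bigr => G _.
by rewrite mulr_sumr.
Qed.

Lemma expectZ (R : comNzRingType) (E : finType) (p a : R)
    (f : {set E} -> R) :
  expect p (fun G => a * f G) = a * expect p f.
Proof. by rewrite /expect mulr_sumr; apply: eq_bigr => G _; rewrite mulrCA. Qed.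

Lemma expectD (R : comNzRingType) (E : finType) (p : R)
    (f g : {set E} -> R) :
  expect p (fun G => f G + g G) = expect p f + expect p g.
Proof. by rewrite /expect -big_split; apply: eq_bigr => G _; rewrite mulrDr. Qed.

Lemma expect1 (R : comNzRingType) (E : finType) (p : R) :
  expect p (fun _ : {set E} => 1) = 1.
Proof.
rewrite /expect; under eq_bigr do rewrite mulr1.
rewrite -(bigA_distr _ _ (fun=> p) (fun=> 1 - p)).
by rewrite big1 // => e _ /=; rewrite addrCA subrr addr0.
Qed.

Lemma ler_expect (R : realType) (E : finType) (p : R) (f g : {set E} -> R) :
  0 <= p <= 1 -> (forall G, f G <= g G) -> expect p f <= expect p g.
Proof.
case/andP=> p0 p1 fg; apply: ler_sum => G _; apply: ler_wpM2l => //.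
by apply: prodr_ge0 => e _; case: ifP; rewrite ?subr_ge0.
Qed.

Lemma expect_ge0 (R : realType) (E : finType) (p : R) (f : {set E} -> R) :
  0 <= p <= 1 -> (forall G, 0 <= f G) -> 0 <= expect p f.
Proof.
case/andP=> p0 p1 f0; apply: sumr_ge0 => G _; apply: mulr_ge0 => //.
by apply: prodr_ge0 => e _; case: ifP; rewrite ?subr_ge0.
Qed.

Lemma depends_onW (T : Type) (E : finType) (D D' : {set E})
    (f : {set E} -> T) :
  D \subset D' -> depends_on D f -> depends_on D' f.
Proof.
by move=> sDD' fD G; rewrite -fD -setIA (setIidPr sDD') fD.
Qed.

Lemma depends_on_comp (T U : Type) (E : finType) (D : {set E})
    (h : T -> U) (f : {set E} -> T) :
  depends_on D f -> depends_on D (fun G => h (f G)).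
Proof. by move=> fD G; rewrite fD. Qed.

Lemma depends_onM (R : comNzRingType) (E : finType) (D D' : {set E})
    (f g : {set E} -> R) :
  depends_on D f -> depends_on D' g ->
  depends_on (D :|: D') (fun G => f G * g G).
Proof.
move=> fD gD' G; congr (_ * _).
  by apply: (depends_onW _ fD); rewrite subsetUl.
by apply: (depends_onW _ gD'); rewrite subsetUr.
Qed.

Lemma natr_and (R : comNzRingType) (a b : bool) :
  (a && b)%:R = a%:R * b%:R :> R.
Proof. by case: a; rewrite ?mul1r ?mul0r. Qed.

(** Two independent copies of the random set may exchange their parts inside D
    without changing their joint law; when f reads only D and g nothing of
    D, the exchange turns f G * g G' into f G' * g G'. *)
Lemma expect_indep (R : comNzRingType) (E : finType) (p : R) (D D' : {set E})
    (f g : {set E} -> R) :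
  depends_on D f -> depends_on D' g -> [disjoint D & D'] ->
  expect p (fun G => f G * g G) = expect p f * expect p g.
Proof.
move=> fD gD' dDD'.
pose w (G : {set E}) : R := \prod_e (if e \in G then p else 1 - p).
pose mix (u : {set E} * {set E}) := (u.1 :&: D) :|: (u.2 :\: D).
pose swap (u : {set E} * {set E}) := (mix (u.2, u.1), mix u).
have swapK : involutive swap.
  case=> G G'; rewrite /swap /mix /=; congr pair; apply/setP => e; rewrite !inE;
  by case: (e \in D); case: (e \in G); case: (e \in G').
have -> : expect p f * expect p g =
    \sum_(u : {set E} * {set E}) (w u.1 * f u.1) * (w u.2 * g u.2).
  rewrite /expect mulr_suml.
  rewrite -(pair_bigA _ (fun G G' => (w G * f G) * (w G' * g G'))) /=.
  by apply: eq_bigr => G _; rewrite mulr_sumr.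
rewrite (reindex_inj (inv_inj swapK)) /=.
transitivity (\sum_(u : {set E} * {set E}) w u.1 * (w u.2 * (f u.2 * g u.2))).
  rewrite -(pair_bigA _ (fun G G' => w G * (w G' * (f G' * g G')))) /=.
  rewrite -[LHS]mul1r -(expect1 E p) /expect mulr_suml.
  by apply: eq_bigr => G _; rewrite mulr1 mulr_sumr.
apply: eq_bigr => -[G G'] _ /=.
have -> : f (mix (G', G)) = f G'.
  rewrite -fD -(fD G'); congr f; apply/setP => e; rewrite !inE.
  by case: (e \in D); case: (e \in G); case: (e \in G').
have -> : g (mix (G, G')) = g G'.
  rewrite -gD' -(gD' G'); congr g; apply/setP => e; rewrite !inE.
  case: (boolP (e \in D')) => eD'; rewrite ?andbF // !andbT.
  by rewrite (disjointFl dDD') ?andbF.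
suff -> : w G * (w G' * (f G' * g G')) =
    (w (mix (G', G)) * w (mix (G, G'))) * (f G' * g G') by ring.
rewrite mulrA; congr (_ * _); rewrite /w -!big_split /=.
apply: eq_bigr => e _; rewrite !inE.
by case: (e \in D); case: (e \in G); case: (e \in G'); rewrite /= ?mulr1 // mulrC.
Qed.

Lemma expect_cylinder (R : comNzRingType) (E : finType) (p : R)
    (D H : {set E}) :
  H \subset D ->
  expect p (fun G => (G :&: D == H)%:R) = p ^+ #|H| * (1 - p) ^+ (#|D| - #|H|).
Proof.
move=> sHD.
pose F1 e : R := if (e \in D) && (e \notin H) then 0 else p.
pose F2 e : R := if (e \in D) && (e \in H) then 0 else 1 - p.
transitivity (\sum_(G : {set E}) \prod_e (if e \in G then F1 e else F2 e)).
  apply: eq_bigr => G _; case: eqP => [defH | neq].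
    rewrite mulr1; apply: eq_bigr => e _; rewrite /F1 /F2 -defH !inE.
    by case: (e \in G); case: (e \in D).
  have [e neq'] : exists e, ~~ ((e \in D) ==> ((e \in G) == (e \in H))).
    apply/existsP; rewrite -negb_forall; apply/negP => /forallP h.
    apply: neq; apply/setP => e; rewrite inE; move: (h e).
    move/subsetP/(_ e): sHD.
    by case: (e \in D); case: (e \in H); case: (e \in G) => // /(_ isT).
  rewrite mulr0 (bigD1 e) //=.
  have -> : (if e \in G then F1 e else F2 e) = 0 :> R.
    rewrite /F1 /F2; move: neq'.
    by case: (e \in D); case: (e \in H); case: (e \in G).
  by rewrite mul0r.
rewrite -(bigA_distr _ _ F1 F2) /=.
rewrite (bigID (mem H)) /= (eq_bigr (fun=> p)); last first.
  by move=> e eH; rewrite /F1 /F2 eH (subsetP sHD) //= addr0.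
rewrite prodr_const; congr (_ * _).
rewrite (bigID (mem D)) /= [X in _ * X]big1 ?mulr1; last first.
  by move=> e /andP[_ /negbTE eD]; rewrite /F1 /F2 eD addrCA subrr addr0.
rewrite (eq_bigr (fun=> 1 - p)); last first.
  by move=> e /andP[/negbTE eH eD]; rewrite /F1 /F2 eH eD /= add0r.
rewrite prodr_const -(cardsDS sHD); congr (_ ^+ _).
by apply: eq_card => e; rewrite !inE.
Qed.

(** Second moment method: pairwise non-positive correlation bounds the variance
    of the number of events by its mean, so Chebyshev's inequality applies with
    deviation equal to the mean. *)
Lemma second_moment (R : realType) (E I : finType) (p : R) (V : pred I)
    (ev : I -> pred {set E}) :
  let mu := \sum_(i | V i) expect p (fun G => (ev i G)%:R) in
  0 <= p <= 1 ->
  \sum_(i | V i) \sum_(j | V j && (j != i))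
     expect p (fun G => (ev i G)%:R * (ev j G)%:R) <= mu ^+ 2 ->
  expect p (fun G => [forall (i | V i), ~~ ev i G]%:R) * mu <= 1.
Proof.
move=> mu p01 le2.
set none := expect p _.
have mu0 : 0 <= mu.
  apply: sumr_ge0 => i _; have <- : expect p (fun _ : {set E} => 0) = 0.
    by rewrite /expect big1 // => G _; rewrite mulr0.
  by apply: ler_expect => // G.
pose X (G : {set E}) : R := \sum_(i | V i) (ev i G)%:R.
have EX : expect p X = mu by exact: expect_sum.
have EX2 : expect p (fun G => X G * X G) <= mu + mu ^+ 2.
  rewrite (@eq_expect _ _ _ _ (fun G => \sum_(i | V i) ((ev i G)%:R +
     \sum_(j | V j && (j != i)) (ev i G)%:R * (ev j G)%:R))); last first.
    move=> G; rewrite /X mulr_suml; apply: eq_bigr => i Vi.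
    rewrite mulr_sumr (bigD1 i) //=; congr (_ + _).
    by case: (ev i G); rewrite ?mulr1 ?mulr0.
  rewrite expect_sum; under eq_bigr do rewrite expectD expect_sum.
  by rewrite big_split /= lerD2l.
have le1 : mu ^+ 2 * none <= mu.
  rewrite -expectZ.
  apply: (@le_trans _ _ (expect p (fun G => X G * X G + (- mu * 2 * X G + mu ^+ 2 * 1)))).
    apply: ler_expect => // G.
    case: (boolP [forall (i | V i), ~~ ev i G]) => [/forallP h|_].
      rewrite /X big1 => [|i Vi]; first by rewrite mulr1n; lra.
      by move/(_ i): h; rewrite Vi /= => /negbTE ->.
    by rewrite mulr0n; have := sqr_ge0 (X G - mu); lra.
  rewrite !expectD !expectZ expect1 EX; lra.
have [->|mu_neq0] := eqVneq mu 0; first by rewrite mulr0 ler01.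
have mu_gt0 : 0 < mu by rewrite lt_def mu_neq0.
rewrite -(ler_pM2r mu_gt0) mul1r; apply: le_trans le1; lra.
Qed.

(** * Edges inside and between vertex sets *)

Definition inner (n : nat) (S : {set 'I_n}) : {set edge n} :=
  [set e : edge n | val e \subset S].

Definition cut (n : nat) (X Y : {set 'I_n}) : {set edge n} :=
  [set e : edge n | [exists x in X, [exists y in Y, val e == [set x; y]]]].

Lemma adjP (n : nat) (G : graph n) (x y : 'I_n) :
  reflect (exists2 e, e \in G & val e = [set x; y]) (adj G x y).
Proof.
by rewrite /adj; apply: (iffP exists_inP) => -[e eG /eqP h]; exists e => //; apply/eqP.
Qed.

Lemma cutP (n : nat) (X Y : {set 'I_n}) (e : edge n) :
  reflect (exists x y, [/\ x \in X, y \in Y & val e = [set x; y]])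
          (e \in cut X Y).
Proof.
rewrite inE; apply: (iffP exists_inP) => [[x xX]|[x [y [xX yY h]]]].
  by case/exists_inP=> y yY /eqP h; exists x, y.
by exists x => //; apply/exists_inP; exists y => //; apply/eqP.
Qed.

Lemma adj_sym (n : nat) (G : graph n) : symmetric (adj G).
Proof. by move=> x y; apply/adjP/adjP => -[e eG h]; exists e; rewrite // setUC. Qed.

Lemma adj_neq (n : nat) (G : graph n) (x y : 'I_n) : adj G x y -> x != y.
Proof.
case/adjP=> e _ h; have := valP e; rewrite h.
by rewrite cards2; case: (x != y).
Qed.

Lemma adj_inner (n : nat) (G : graph n) (V : {set 'I_n}) (x y : 'I_n) :
  adj (G :&: inner V) x y = [&& x \in V, y \in V & adj G x y].
Proof.
apply/adjP/and3P => [[e]|[xV yV /adjP[e eG h]]].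
  rewrite !inE => /andP[eG sV] h; move: sV.
  rewrite h subUset !sub1set => /andP[-> ->]; split=> //.
  by apply/adjP; exists e.
by exists e => //; rewrite !inE eG h subUset !sub1set xV.
Qed.

Lemma cut_eq0P (n : nat) (G : graph n) (X Y : {set 'I_n}) :
  reflect (forall x y, x \in X -> y \in Y -> ~~ adj G x y)
          (G :&: cut X Y == set0).
Proof.
apply: (iffP eqP) => [h x y xX yY|h].
  apply/negP => /adjP[e eG exy]; suff : e \in G :&: cut X Y by rewrite h inE.
  by rewrite inE eG; apply/cutP; exists x, y.
apply/setP => e; rewrite in_setI in_set0; apply/negP => /andP[eG].
case/cutP=> x [y [xX yY exy]]; move/negP: (h x y xX yY); apply.
by apply/adjP; exists e.
Qed.

Lemma card_cut (n : nat) (X Y : {set 'I_n}) :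
  [disjoint X & Y] -> #|cut X Y| = (#|X| * #|Y|)%N.
Proof.
move=> dXY; rewrite -cardsX.
have injval : {in cut X Y &, injective (val : edge n -> {set 'I_n})}.
  by move=> ? ? _ _; apply: val_inj.
rewrite -(card_in_imset injval).
pose pair2 (u : 'I_n * 'I_n) := [set u.1; u.2].
have injp : {in setX X Y &, injective pair2}.
  move=> [x y] [x' y']; rewrite !in_setX /= => /andP[xX yY] /andP[x'X y'Y].
  rewrite /pair2 /= => /setP h.
  have : x \in [set x'; y'] by rewrite -h !inE eqxx.
  have : y \in [set x'; y'] by rewrite -h !inE eqxx orbT.
  rewrite !inE; case: eqP => [yx'|_ /= /eqP ->].
    by move: yY; rewrite yx' (disjointFr dXY x'X).
  case: eqP => [-> //|_ /= /eqP xy'].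
  by move: y'Y; rewrite -xy' (disjointFr dXY xX).
rewrite -(card_in_imset injp); apply: eq_card => s.
apply/imsetP/imsetP => [[e /cutP[x [y [xX yY h]]] ->]|[[x y]]].
  by exists (x, y); rewrite ?in_setX ?xX.
rewrite in_setX /= => /andP[xX yY] ->.
have c2 : #|[set x; y]| == 2%N.
  rewrite cards2; case: (eqVneq x y) => // xy.
  by move: yY; rewrite -xy (disjointFr dXY xX).
by exists (Sub [set x; y] c2 : edge n) => //; apply/cutP; exists x, y.
Qed.

Lemma cutC (n : nat) (X Y : {set 'I_n}) : cut X Y = cut Y X.
Proof.
by apply/setP => e; apply/cutP/cutP => -[x [y [xX yY ->]]]; exists y, x; rewrite setUC.
Qed.

Lemma disjoint_setC (T : finType) (S : {set T}) : [disjoint S & ~: S].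
Proof. by rewrite -setI_eq0 setICr. Qed.

Lemma card_setC_ord (n : nat) (S : {set 'I_n}) : #|~: S| = (n - #|S|)%N.
Proof. by rewrite cardsCs setCK card_ord. Qed.

Lemma inner_cut_disjoint (n : nat) (V X Y : {set 'I_n}) :
  [disjoint V & Y] -> [disjoint inner V & cut X Y].
Proof.
move=> dVY; rewrite disjoint_subset; apply/subsetP => e.
rewrite inE => sV; apply/negP => /cutP[x [y [_ yY exy]]].
move: sV; rewrite exy subUset !sub1set => /andP[_ yV].
by rewrite (disjointFr dVY yV) in yY.
Qed.

Lemma inner_disjoint (n : nat) (S T : {set 'I_n}) :
  [disjoint S & T] -> [disjoint inner S & inner T].
Proof.
move=> dST; rewrite disjoint_subset; apply/subsetP => e; rewrite !inE => eS.
apply/negP => eT; have /card_gt0P[x xe] : (0 < #|val e|)%N by rewrite (eqP (valP e)).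
by have := subsetP eT x xe; rewrite (disjointFr dST (subsetP eS x xe)).
Qed.

Lemma cut_disjoint (n : nat) (S T : {set 'I_n}) :
  [disjoint S & T] -> [disjoint cut S (~: S) & cut T (~: (S :|: T))].
Proof.
move=> dST; rewrite disjoint_subset; apply/subsetP => e.
case/cutP=> x [y [xS _ exy]]; apply/negP => /cutP[u [v [uT vST euv]]].
have : x \in [set u; v] by rewrite -euv exy !inE eqxx.
rewrite !inE => /orP[/eqP xu|/eqP xv].
  by move: uT; rewrite -xu (disjointFr dST xS).
by move: vST; rewrite -xv !inE xS.
Qed.

(** * Exploration of a graph from a set of vertices *)

Definition nbrs (n : nat) (B : {set 'I_n}) (x : 'I_n) (G : graph n) :
    {set 'I_n} :=
  [set y in B | adj G x y].

Lemma nbrs_eq (n : nat) (B J : {set 'I_n}) (x : 'I_n) (G : graph n) :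
  x \notin B -> J \subset B ->
  (nbrs B x G == J) = (G :&: cut [set x] B == cut [set x] J).
Proof.
move=> xB sJB; apply/eqP/eqP => [<-|h].
  apply/setP => e; rewrite in_setI.
  apply/andP/cutP => [[eG /cutP[_ [y [/set1P -> yB exy]]]]|].
    exists x, y; rewrite !inE eqxx yB; split=> //.
    by apply/adjP; exists e.
  case=> _ [y [/set1P ->]]; rewrite inE => /andP[yB /adjP[e' eG' exy']] exy.
  have -> : e = e' by apply: val_inj; rewrite /= exy exy'.
  by split=> //; apply/cutP; exists x, y; rewrite inE eqxx.
apply/setP => y; rewrite inE; apply/andP/idP => [[yB /adjP[e eG exy]]|yJ].
  have : e \in cut [set x] J.
    by rewrite -h inE eG; apply/cutP; exists x, y; rewrite inE eqxx.
  case/cutP=> _ [z [/set1P -> zJ]]; rewrite exy => /setP exz.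
  have /adj_neq : adj G x y by apply/adjP; exists e.
  have := exz y; rewrite !inE eqxx orbT eq_sym => /esym.
  by case: eqP => //= _ /eqP ->.
have yB := subsetP sJB y yJ; split=> //.
have c2 : #|[set x; y]| == 2%N.
  by rewrite cards2; case: (eqVneq x y) => // xy; rewrite xy yB in xB.
have : (Sub [set x; y] c2 : edge n) \in cut [set x] J.
  by apply/cutP; exists x, y; rewrite inE eqxx.
by rewrite -h inE => /andP[eG _]; apply/adjP; exists (Sub [set x; y] c2).
Qed.

(** A stands for the discovered but unexplored vertices and B for the undiscovered
    ones. Confining the paths to A :|: B makes the event independent of the edges
    at vertices explored earlier. *)
Definition reaches (n : nat) (A B : {set 'I_n}) (G : graph n) : bool :=
  [forall y in B, [exists x in A, connect (adj (G :&: inner (A :|: B))) x y]].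

Lemma reachesP (n : nat) (A B : {set 'I_n}) (G : graph n) :
  reflect (forall y, y \in B ->
             exists2 x, x \in A & connect (adj (G :&: inner (A :|: B))) x y)
          (reaches A B G).
Proof.
apply: (iffP forall_inP) => h y yB; first by apply/exists_inP; apply: h.
by apply/exists_inP; apply: h.
Qed.

Lemma depends_on_reaches (n : nat) (A B : {set 'I_n}) :
  depends_on (inner (A :|: B)) (reaches A B).
Proof. by move=> G; rewrite /reaches -setIA setIid. Qed.

Lemma depends_on_cut_eq (n : nat) (X Y : {set 'I_n}) (H : graph n) :
  depends_on (cut X Y) (fun G => G :&: cut X Y == H).
Proof. by move=> G; rewrite -setIA setIid. Qed.

Lemma connect_preserves (T : finType) (e : rel T) (P : T -> Prop) (x y : T) :
  (forall u v, e u v -> P u -> P v) -> connect e x y -> P x -> P y.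
Proof.
move=> stepP /connectP[s + ->]; elim: s x => //= z s IHs x /andP[exz pzs] Px.
exact: IHs pzs (stepP _ _ exz Px).
Qed.

(** Exploring x moves its undiscovered neighbours into the active set; a path that
    leaves x for the last time does so through one of these neighbours or
    through another active vertex, and never needs x again. *)
Lemma reaches_step (n : nat) (A B : {set 'I_n}) (x : 'I_n) (G : graph n) :
  x \in A -> [disjoint A & B] ->
  reaches A B G = reaches (A :\ x :|: nbrs B x G) (B :\: nbrs B x G) G.
Proof.
move=> xA dAB; set I := nbrs B x G; pose V := (A :\ x :|: I) :|: (B :\: I).
have sIB : I \subset B by apply/subsetP => y; rewrite inE => /andP[].
have xB : x \notin B by rewrite (disjointFr dAB xA).
have defV : V = (A :|: B) :\ x.
  apply/setP => y; rewrite !inE; case: eqP => [->|_] /=.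
    by rewrite (negbTE xB) !andbF.
  by case: (y \in A); case: (y \in B); case: (adj G x y).
apply/reachesP/reachesP => h y.
- rewrite in_setD => /andP[yI yB]; have [a aA cay] := h y yB.
  (* Along a path from A, every vertex other than x stays reachable without x. *)
  pose P y := y = x \/
    exists2 z, z \in A :\ x :|: I & connect (adj (G :&: inner V)) z y.
  suff [yx|//] : P y by rewrite -yx yB in xB.
  apply: connect_preserves cay _; last first.
    have [->|nax] := eqVneq a x; first by left.
    by right; exists a; rewrite ?connect0 // in_setU in_setD1 nax aA.
  move=> u v; rewrite adj_inner => /and3P[uV vV auv] Pu.
  have [->|nvx] := eqVneq v x; first by left.
  right; case: Pu => [ux|[z zA' czu]].
    rewrite ux in auv; exists v; rewrite ?connect0 //.
    by move: vV; rewrite !inE nvx /= auv andbT.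
  have [ux|nux] := eqVneq u x.
    rewrite ux in auv; exists v; rewrite ?connect0 //.
    by move: vV; rewrite !inE nvx /= auv andbT.
  exists z => //; apply: connect_trans czu (connect1 _).
  by rewrite adj_inner defV !in_setD1 nvx nux uV vV.
- move=> yB.
  have lift a : connect (adj (G :&: inner V)) a y ->
      connect (adj (G :&: inner (A :|: B))) a y.
    apply: connect_sub => u v; rewrite adj_inner defV !in_setD1.
    case/and3P=> /andP[_ uV] /andP[_ vV] auv; apply: connect1.
    by rewrite adj_inner uV vV.
  have toI a : a \in I -> connect (adj (G :&: inner (A :|: B))) x a.
    rewrite inE => /andP[aB axa]; apply: connect1.
    by rewrite adj_inner !in_setU xA aB orbT.
  have [yI|yI] := boolP (y \in I); first by exists x; last exact: toI.
  have /h[a] : y \in B :\: I by rewrite in_setD yI.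
  rewrite in_setU in_setD1 => /orP[/andP[_ aA]|aI] cay.
    by exists a; last exact: lift.
  by exists x => //; apply: connect_trans (toI a aI) (lift a cay).
Qed.

(** * Probability that an exploration exhausts a vertex set *)

(** The recursion satisfied by the probability of [reaches A B] with #|A| = a,
    #|B| = b and m = a + b: exploring one active vertex discovers i new vertices
    with a binomial law and lowers a + b by one. Being a function of the
    cardinalities alone, it also shows that all sets of a given size are equally
    likely to be connected. *)
Fixpoint reach_prob (R : comNzRingType) (p : R) (m a b : nat) {struct m} : R :=
  match m, a with
  | m'.+1, a'.+1 =>
      \sum_(i < b.+1)
        (p ^+ i * (1 - p) ^+ (b - i) * reach_prob p m' (a' + i) (b - i))
        *+ 'C(b, i)
  | _, _ => (b == 0)%N%:R
  end.

Lemma big_subset_card (R : nmodType) (T : finType) (B : {set T}) (f : nat -> R) :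
  \sum_(J : {set T} | J \subset B) f #|J| =
  \sum_(i < #|B|.+1) f i *+ 'C(#|B|, i).
Proof.
pose k (J : {set T}) : 'I_#|B|.+1 := inord #|J|.
rewrite (partition_big k predT) //=; apply: eq_bigr => i _.
rewrite (eq_bigr (fun=> f i)); last first.
  move=> J /andP[sJB /eqP <-]; rewrite inordK // ltnS; exact: subset_leq_card.
rewrite sumr_const -(cards_draws B i); congr (_ *+ _).
apply: eq_card => J; rewrite !inE [in LHS]unfold_in /=.
case sJB: (J \subset B) => //=; apply/eqP/eqP => [<-|h].
  by rewrite inordK // ltnS subset_leq_card.
by apply: val_inj; rewrite /= inordK // ltnS subset_leq_card.
Qed.

(** The neighbours of the explored vertex x are decided by the edges from x to B,
    and what follows depends only on edges that avoid x. *)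
Lemma expect_reaches (R : comNzRingType) (n : nat) (p : R) (m : nat)
    (A B : {set 'I_n}) :
  [disjoint A & B] -> (#|A| + #|B|)%N = m ->
  expect p (fun G => (reaches A B G)%:R) = reach_prob p m #|A| #|B|.
Proof.
have empty (A' B' : {set 'I_n}) : #|A'| = 0%N ->
    expect p (fun G => (reaches A' B' G)%:R) = (#|B'| == 0)%N%:R.
  move/eqP; rewrite cards_eq0 => /eqP ->; rewrite cards_eq0.
  rewrite (@eq_expect _ _ _ _ (fun=> (B' == set0)%:R * 1)).
    by rewrite expectZ expect1 mulr1.
  move=> G; rewrite mulr1; congr (_%:R); apply: congr1.
  apply/reachesP/eqP => [h|-> y]; last by rewrite inE.
  by apply/setP => y; rewrite inE; apply/negP => /h[x]; rewrite inE.
elim: m A B => [|m IHm] A B dAB cAB.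
  by move/eqP: cAB; rewrite addn_eq0 => /andP[/eqP a0 _]; rewrite empty ?a0.
rewrite /=; case defa: #|A| => [|a]; first exact: empty.
have [x xA] : exists x, x \in A by apply/card_gt0P; rewrite defa.
have xB : x \notin B by rewrite (disjointFr dAB xA).
pose A' (J : {set 'I_n}) := A :\ x :|: J; pose B' (J : {set 'I_n}) := B :\: J.
rewrite (@eq_expect _ _ _ _ (fun G => \sum_(J : {set 'I_n} | J \subset B)
   (G :&: cut [set x] B == cut [set x] J)%:R * (reaches (A' J) (B' J) G)%:R));
  last first.
  move=> G; rewrite (bigD1 (nbrs B x G)) /=; last first.
    by apply/subsetP => y; rewrite inE => /andP[].
  have sNB : nbrs B x G \subset B by apply/subsetP => y; rewrite inE => /andP[].
  rewrite -nbrs_eq // eqxx mul1r (reaches_step _ xA dAB) big1 ?addr0 // => J.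
  by case/andP=> sJB nJ; rewrite -nbrs_eq // eq_sym (negbTE nJ) mul0r.
rewrite expect_sum -(big_subset_card B (fun i => p ^+ i * (1 - p) ^+ (#|B| - i) *
  reach_prob p m (a + i) (#|B| - i))).
apply: eq_bigr => J sJB.
have xJ : [disjoint [set x] & J].
  by rewrite disjoints1; apply: contra xB => /(subsetP sJB).
have dxB : [disjoint [set x] & B] by rewrite disjoints1.
have cB' : #|B' J| = (#|B| - #|J|)%N by rewrite cardsDS.
have cA' : #|A' J| = (a + #|J|)%N.
  rewrite (cardsD1 x A) xA in defa; rewrite cardsU.
  have -> : (A :\ x) :&: J = set0.
    apply/setP => y; rewrite !inE; apply/negP => /andP[/andP[_ yA] /(subsetP sJB)].
    by rewrite (disjointFr dAB yA).
  by rewrite cards0 subn0; move: defa; rewrite add1n => -[->].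
rewrite (@expect_indep _ _ _ (cut [set x] B) (inner (A' J :|: B' J))).
- rewrite expect_cylinder; last first.
    apply/subsetP => e /cutP[_ [y [/set1P -> yJ h]]]; apply/cutP; exists x, y.
    by rewrite inE eqxx (subsetP sJB).
  rewrite !card_cut // cards1 !mul1n IHm ?cA' ?cB' //.
    rewrite disjoint_subset; apply/subsetP => y; rewrite !inE.
    case/orP=> [/andP[_ yA]|->//].
    by rewrite (disjointFr dAB yA) andbF.
  move: (subset_leq_card sJB); lia.
- exact: (depends_on_comp (fun b : bool => b%:R)) (@depends_on_cut_eq _ _ _ _).
- exact: (depends_on_comp (fun b : bool => b%:R)) (@depends_on_reaches _ _ _).
rewrite disjoint_sym cutC; apply: inner_cut_disjoint.
rewrite disjoint_sym disjoints1 !inE eqxx /= (negbTE xB) andbF orbF.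
by apply: contra xB => /(subsetP sJB).
Qed.

(** * Connected components *)

Lemma in_components (n : nat) (G : graph n) (S : {set 'I_n}) (x : 'I_n) :
  x \in S ->
  (S \in components G) =
    reaches [set x] (S :\ x) G && (G :&: cut S (~: S) == set0).
Proof.
move=> xS; have csym : connect_sym (adj G) by apply/sym_connect_sym/adj_sym.
have defS : [set x] :|: S :\ x = S by rewrite setD1K.
apply/imsetP/andP => [[z _ defSz]|[/reachesP reach /cut_eq0P noout]].
  have czx : connect (adj G) z x by move: xS; rewrite defSz inE.
  have inS y : (y \in S) = connect (adj G) x y.
    by rewrite defSz inE; apply: same_connect.
  split.
    apply/reachesP => y; rewrite defS in_setD1 inS => /andP[_ cxy].
    exists x; first by rewrite inE.
    pose P v := connect (adj G) x v /\ connect (adj (G :&: inner S)) x v.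
    suff [] : P y by [].
    apply: (@connect_preserves _ _ P _ _ _ cxy); last by rewrite /P !connect0.
    move=> u v auv [cxu cuS]; have cxv := connect_trans cxu (connect1 auv).
    split=> //; apply: connect_trans cuS (connect1 _).
    by rewrite adj_inner !inS cxu cxv.
  apply/cut_eq0P => u v; rewrite in_setC !inS => cxu; apply: contra => auv.
  exact: connect_trans cxu (connect1 auv).
exists x => //; apply/setP => y; rewrite inE; apply/idP/idP => [yS|cxy].
  have [->|nyx] := eqVneq y x; first exact: connect0.
  have /reach[_ /set1P ->] : y \in S :\ x by rewrite in_setD1 nyx.
  apply: connect_sub => u v; rewrite adj_inner => /and3P[_ _ auv].
  exact: connect1.
apply: (@connect_preserves _ _ (fun v => v \in S) _ _ _ cxy xS) => u v auv uS.
by apply: contraTT auv => vS; apply: noout; rewrite ?in_setC.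
Qed.

Lemma components_disjoint (n : nat) (G : graph n) (S T : {set 'I_n}) :
  S \in components G -> T \in components G -> S != T -> [disjoint S & T].
Proof.
have csym : connect_sym (adj G) by apply/sym_connect_sym/adj_sym.
case/imsetP=> x _ -> /imsetP[y _ ->]; apply: contraR => /pred0Pn[z /=].
rewrite !inE => /andP[cxz cyz]; apply/eqP/setP => u; rewrite !inE.
by apply: (same_connect csym); apply: connect_trans cxz _; rewrite csym.
Qed.

(** The probability that G(s, p) is connected, for s > 0: the exploration starts
    with one active vertex. *)
Definition conn_prob (R : comNzRingType) (p : R) (s : nat) : R :=
  reach_prob p s 1 s.-1.

Lemma expect_cut_eq0 (R : comNzRingType) (n : nat) (p : R)
    (X Y : {set 'I_n}) :
  [disjoint X & Y] ->
  expect p (fun G => (G :&: cut X Y == set0)%:R) = (1 - p) ^+ (#|X| * #|Y|).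
Proof.
by move=> dXY; rewrite expect_cylinder ?sub0set // cards0 mul1r subn0 card_cut.
Qed.

Lemma expect_connected (R : comNzRingType) (n : nat) (p : R)
    (S : {set 'I_n}) (x : 'I_n) :
  x \in S ->
  expect p (fun G => (reaches [set x] (S :\ x) G)%:R) = conn_prob p #|S|.
Proof.
move=> xS; have cS := cardsD1 x S; rewrite xS add1n in cS.
rewrite (@expect_reaches _ _ _ #|S|) ?cards1 ?add1n //.
  by rewrite /conn_prob cS.
by rewrite disjoints1 !inE eqxx.
Qed.

Lemma depends_on_connected (n : nat) (S : {set 'I_n}) (x : 'I_n) :
  x \in S -> depends_on (inner S) (reaches [set x] (S :\ x)).
Proof. by move=> xS; rewrite -{1}(setD1K xS); apply: depends_on_reaches. Qed.

Lemma expect_component (R : comNzRingType) (n : nat) (p : R)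
    (S : {set 'I_n}) :
  (0 < #|S|)%N ->
  expect p (fun G => (S \in components G)%:R) =
    conn_prob p #|S| * (1 - p) ^+ (#|S| * (n - #|S|)).
Proof.
case/card_gt0P=> x xS.
under eq_expect do rewrite (in_components _ xS) natr_and.
rewrite (@expect_indep _ _ _ (inner S) (cut S (~: S))).
- rewrite expect_connected // expect_cut_eq0 ?disjoint_setC //.
  by rewrite card_setC_ord.
- exact: (depends_on_comp (fun b : bool => b%:R)) (depends_on_connected xS).
- exact: (depends_on_comp (fun b : bool => b%:R)) (@depends_on_cut_eq _ _ _ _).
by apply: inner_cut_disjoint; exact: disjoint_setC.
Qed.

(** The edges between S and T are counted once only, in the cut of S, so the
    exponent of 1 - p for T is #|T| * (n - #|S| - #|T|). The independent events
    used depend on the edges inside S, inside T, in the cut of S and in the cut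
    between T and the outside of S :|: T. *)
Lemma expect_component2 (R : realType) (n : nat) (p : R)
    (S T : {set 'I_n}) :
  0 <= p <= 1 -> (0 < #|S|)%N -> (0 < #|T|)%N -> [disjoint S & T] ->
  expect p (fun G => (S \in components G)%:R * (T \in components G)%:R) <=
    (conn_prob p #|S| * (1 - p) ^+ (#|S| * (n - #|S|))) *
    (conn_prob p #|T| * (1 - p) ^+ (#|T| * (n - #|S| - #|T|))).
Proof.
move=> p01 /card_gt0P[x xS] /card_gt0P[y yT] dST.
have dTS : [disjoint T & S] by rewrite disjoint_sym.
pose rS (G : graph n) : R := (reaches [set x] (S :\ x) G)%:R.
pose rT (G : graph n) : R := (reaches [set y] (T :\ y) G)%:R.
pose oS (G : graph n) : R := (G :&: cut S (~: S) == set0)%:R.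
pose oT (G : graph n) : R := (G :&: cut T (~: (S :|: T)) == set0)%:R.
apply: (@le_trans _ _ (expect p (fun G => (rS G * rT G) * (oS G * oT G)))).
  apply: ler_expect => // G; rewrite (in_components _ xS) (in_components _ yT).
  rewrite !natr_and -/(rS G) -/(rT G) -/(oS G) mulrACA.
  rewrite !ler_wpM2l ?mulr_ge0 ?ler0n // ler_nat.
  case: cut_eq0P => // noout; rewrite (introT (cut_eq0P _ _ _)) // => u v uT.
  by rewrite setCU in_setI => /andP[_]; apply: noout.
have b2R := depends_on_comp (fun b : bool => b%:R : R).
have drS : depends_on (inner S) rS by exact: b2R (depends_on_connected xS).
have drT : depends_on (inner T) rT by exact: b2R (depends_on_connected yT).
have doS : depends_on (cut S (~: S)) oS by exact: b2R (@depends_on_cut_eq _ _ _ _).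
have doT : depends_on (cut T (~: (S :|: T))) oT.
  by exact: b2R (@depends_on_cut_eq _ _ _ _).
have dTST : [disjoint T & ~: (S :|: T)].
  by rewrite setCU -setI_eq0 setICA setICr setI0.
rewrite (expect_indep _ (depends_onM drS drT) (depends_onM doS doT)); last first.
  rewrite -setI_eq0 !setIUl !setIUr !setU_eq0 !setI_eq0.
  rewrite (inner_cut_disjoint _ (disjoint_setC S)) (inner_cut_disjoint _ dTST).
  rewrite [cut S _]cutC (inner_cut_disjoint _ dTS) /= andbT.
  apply: inner_cut_disjoint; rewrite setCU -setI_eq0 setIA setICr set0I //.
rewrite (expect_indep _ drS drT) ?inner_disjoint //.
rewrite (expect_indep _ doS doT) ?cut_disjoint //.
rewrite !expect_connected // !expect_cut_eq0 ?disjoint_setC //.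
rewrite mulrACA !card_setC_ord.
by rewrite cardsU disjoint_setI0 // cards0 subn0 subnDA.
Qed.

(** * The second moment of the number of components *)

Lemma bernoulli (R : realType) (p : R) (s : nat) :
  0 <= p <= 1 -> 1 - s%:R * p <= (1 - p) ^+ s.
Proof.
case/andP=> p0 p1; elim: s => [|s IHs]; first by rewrite expr0; lra.
have q0 : 0 <= 1 - p by lra.
have := ler_wpM2l q0 IHs; rewrite -exprS -natr1.
have : 0 <= s%:R :> R by []. nra.
Qed.

(** A uniform t-set avoids a given s-set with probability at most (1 - s/n)^t, and
    1 - s/n <= 1 - s p <= (1 - p)^s. *)
Lemma binD_le (R : realType) (p : R) (n s t : nat) :
  0 <= p -> n%:R * p <= 1 -> (0 < n)%N ->
  ('C(n - s, t))%:R <= ('C(n, t))%:R * (1 - p) ^+ (s * t) :> R.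
Proof.
move=> p0 np1 n0; have n0R : 0 < n%:R :> R by rewrite ltr0n.
have n1R : 1 <= n%:R :> R by rewrite ler1n.
have p1 : p <= 1 by nra.
have q0 : 0 <= 1 - p by lra.
have [lt_ns|le_sn] := ltnP n s.
  have [->|t0] := posnP t; first by rewrite muln0 !bin0 mulr1.
  rewrite bin_small; last by move: lt_ns t0; lia.
  by rewrite mulr_ge0 ?exprn_ge0.
have lenq : n%:R - s%:R <= n%:R * (1 - p) ^+ s.
  apply: le_trans (ler_wpM2l (ltW n0R) (@bernoulli _ p s _)); last by rewrite p0.
  have : 0 <= s%:R :> R by []. nra.
suff le_ffact : ((n - s) ^_ t)%:R <= (n ^_ t)%:R * (1 - p) ^+ (s * t) :> R.
  have f0 : 0 < t`!%:R :> R by rewrite ltr0n fact_gt0.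
  by rewrite -(ler_pM2r f0) mulrAC -!natrM !bin_ffact.
elim: t => [|t IHt]; first by rewrite muln0 !ffactn0 mulr1.
rewrite !ffactnSr mulnS addnC exprD !natrM.
apply: (@le_trans _ _ ((n ^_ t)%:R * (1 - p) ^+ (s * t) * (n - s - t)%:R)).
  by rewrite ler_wpM2r.
rewrite -!mulrA; apply: ler_wpM2l => //; rewrite mulrCA.
rewrite ler_wpM2l ?exprn_ge0 //.
have [lt|le] := ltnP (n - s) t.
  by rewrite (eqP (ltnW lt)) mulr_ge0 ?exprn_ge0.
rewrite -(ler_pM2l n0R) mulrCA.
apply: le_trans (ler_wpM2l (ler0n _ _) lenq).
rewrite !natrB //; last by lia.
have : 0 <= s%:R * t%:R :> R by apply: mulr_ge0. nra.
Qed.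

(** The mean number of components with s > 0 vertices in G(n, p). *)
Definition mean_comp (R : comNzRingType) (n : nat) (p : R) (s : nat) : R :=
  conn_prob p s * (1 - p) ^+ (s * (n - s)) *+ 'C(n, s).

Lemma conn_prob_ge0 (R : realType) (p : R) (s : nat) :
  0 <= p <= 1 -> 0 <= conn_prob p s.
Proof.
case/andP=> p0 p1; rewrite /conn_prob; elim: {1}s 1%N s.-1 => [|m IHm] [|a] b //=.
by apply: sumr_ge0 => i _; rewrite mulrn_wge0 ?mulr_ge0 ?exprn_ge0 ?subr_ge0.
Qed.

(** The pair bound of [expect_component2] lacks a factor (1 - p)^(s t) compared to
    the product of the two probabilities; the number of sets of size t disjoint
    from a set of size s makes up for it by [binD_le]. Hence distinct components
    satisfy the hypothesis of the second moment method. *)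
Lemma no_component_bound (R : realType) (n : nat) (p : R) (V : pred nat) :
  0 <= p -> n%:R * p <= 1 -> (0 < n)%N -> ~~ V 0%N ->
  expect p (fun G : graph n =>
    [forall (S : {set 'I_n} | V #|S|), S \notin components G]%:R) *
  (\sum_(s < n.+1 | V s) mean_comp n p s) <= 1.
Proof.
move=> p0 np1 n0 V0.
have n1R : 1 <= n%:R :> R by rewrite ler1n.
have p1 : p <= 1 by nra.
have p01 : 0 <= p <= 1 by rewrite p0.
have q0 : 0 <= 1 - p by lra.
have Vpos (S : {set 'I_n}) : V #|S| -> (0 < #|S|)%N.
  by case: #|S| => // h; rewrite h in V0.
pose c s := conn_prob p s * (1 - p) ^+ (s * (n - s)).
have defmu : \sum_(s < n.+1 | V s) mean_comp n p s =
    \sum_(S : {set 'I_n} | V #|S|) expect p (fun G => (S \in components G)%:R).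
  rewrite (eq_bigr (fun S : {set 'I_n} => c #|S|)); last first.
    by move=> S VS; apply: expect_component; apply: Vpos.
  rewrite [RHS]big_mkcond /=.
  transitivity (\sum_(S : {set 'I_n} | S \subset setT)
      (if V #|S| then c #|S| else 0)); last first.
    by apply: eq_bigl => S; rewrite subsetT.
  rewrite (big_subset_card setT (fun s => if V s then c s else 0)).
  rewrite cardsT card_ord big_mkcond /=; apply: eq_bigr => s _.
  by case: (V s); rewrite ?mul0rn.
rewrite defmu; apply: second_moment => //; rewrite -defmu.
rewrite expr2 [X in X * _]defmu mulr_suml; apply: ler_sum => S VS.
have S0 := Vpos S VS.
apply: (@le_trans _ _ (\sum_(T : {set 'I_n} | T \subset ~: S)
  c #|S| * (if V #|T| then
    conn_prob p #|T| * (1 - p) ^+ (#|T| * (n - #|S| - #|T|)) else 0))).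
  rewrite [X in X <= _]big_mkcond [X in _ <= X]big_mkcond; apply: ler_sum => T _.
  case VT: (V #|T|) => /=; last by rewrite mulr0; case: ifP.
  case: eqP => [->|/eqP nTS] /=.
    case: ifP => // _; rewrite !mulr_ge0 ?exprn_ge0 ?conn_prob_ge0 //.
  rewrite subsets_disjoint setCK; case dTS: [disjoint T & S].
    by apply: expect_component2; rewrite ?Vpos // disjoint_sym.
  rewrite (@eq_expect _ _ _ _ (fun=> 0 * 1)) => [|G].
    by rewrite expectZ mul0r.
  rewrite mul0r -natr_and; apply/eqP; rewrite pnatr_eq0 eqb0.
  apply/negP => /andP[SG TG].
  by rewrite (components_disjoint TG SG nTS) in dTS.
rewrite -mulr_sumr expect_component //; apply: ler_wpM2l.
  by rewrite mulr_ge0 ?exprn_ge0 ?conn_prob_ge0.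
rewrite (big_subset_card (~: S) (fun t => if V t then
  conn_prob p t * (1 - p) ^+ (t * (n - #|S| - t)) else 0)).
rewrite card_setC_ord.
set s := #|S|; have le_sn : (s <= n)%N by rewrite -[n in (_ <= n)%N]card_ord max_card.
have le_ns : ((n - s).+1 <= n.+1)%N by lia.
rewrite (big_ord_widen _ (fun t => (if V t then
  conn_prob p t * (1 - p) ^+ (t * (n - s - t)) else 0) *+ 'C(n - s, t)) le_ns).
rewrite [X in X <= _]big_mkcond [X in _ <= X]big_mkcond; apply: ler_sum => t _ /=.
have c0 := conn_prob_ge0 t p01.
case: (V t); last by rewrite mul0rn if_same.
case: ltnP => le_tns; last by rewrite mulrn_wge0 ?mulr_ge0 ?exprn_ge0.
rewrite /mean_comp -![(_ * _) *+ _]mulr_natr -!mulrA ler_wpM2l //.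
apply: le_trans (ler_wpM2l (exprn_ge0 _ q0) (binD_le s t p0 np1 n0)) _.
suff -> : (t * (n - t) = t * (n - s - t) + s * t)%N.
  by rewrite exprD mulrCA mulrC.
rewrite [(s * t)%N]mulnC -mulnDr; congr (_ * _)%N; lia.
Qed.

(** * Cayley-type lower bound for the probability of connectedness *)

Lemma sum_bin_index (R : comNzRingType) (x : R) (b : nat) :
  \sum_(i < b.+1) (i%:R * x ^+ (b - i)) *+ 'C(b, i) =
  b%:R * (x + 1) ^+ b.-1.
Proof.
case: b => [|b]; first by rewrite big_ord1 /= !mul0r mul0rn.
rewrite big_ord_recl /= mul0r mul0rn add0r exprDn mulr_sumr.
apply: eq_bigr => i _; rewrite /bump /= add1n subSS expr1n mulr1.
rewrite -mulr_natr mulrAC -natrM -mul_bin_diag natrM /= -mulrA; congr (_ * _).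
by rewrite mulrC mulr_natr.
Qed.

Lemma bin2D (i j : nat) : ('C(i + j, 2) = 'C(i, 2) + i * j + 'C(j, 2))%N.
Proof.
elim: i => [|i IHi]; first by rewrite add0n mul0n bin0n.
by rewrite addSn !binS IHi !bin1; lia.
Qed.

(** There are a (a + b)^(b - 1) forests on a + b vertices whose roots are a given
    set of a vertices, and this number satisfies the recursion of the exploration.
    A forest has b edges, and at most a b + C(b, 2) pairs of vertices are left to
    be non-edges. The bound is multiplied by m = a + b to avoid the exponent
    b - 1, and then holds for b = 0 as well. *)
Lemma reach_prob_ge (R : realType) (p : R) (m a b : nat) :
  0 <= p <= 1 -> (a + b)%N = m ->
  a%:R * m%:R ^+ b * (p ^+ b * (1 - p) ^+ (a * b + 'C(b, 2))) <=
  m%:R * reach_prob p m a b.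
Proof.
case/andP=> p0 p1; have q0 : 0 <= 1 - p by lra.
have q1 : 1 - p <= 1 by lra.
elim: m a b => [|m IHm] [|a] b //=; rewrite ?mul0r ?mulr_ge0 //.
rewrite addSn => -[abm].
have [m0|m_gt0] := posnP m.
  have [a0 b0] : a = 0%N /\ b = 0%N by lia.
  by rewrite m0 a0 b0 big_ord1 /= !expr0 !mulr1.
have mR : 0 < m%:R :> R by rewrite ltr0n.
set Q := (1 - p) ^+ (a.+1 * b + _).
have Q0 : 0 <= p ^+ b * Q by rewrite mulr_ge0 ?exprn_ge0.
rewrite -(ler_pM2l mR) [X in _ <= X]mulrCA.
apply: (@le_trans _ _ (m.+1%:R * (p ^+ b * Q *
    (a%:R * (m%:R + 1) ^+ b + b%:R * (m%:R + 1) ^+ b.-1)))).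
  rewrite natr1; case: b abm @Q Q0 => [|b] abm Q Q0.
    have -> : m = a by lia.
    by rewrite le_eqVlt; apply/orP; left; apply/eqP; rewrite /= -natr1; ring.
  rewrite /= -abm addnS -!natr1 natrD !exprS.
  rewrite le_eqVlt; apply/orP; left; apply/eqP; ring.
rewrite ler_wpM2l // mulr_sumr -sum_bin_index exprDn mulr_sumr -big_split /= mulr_sumr.
apply: ler_sum => i _; have le_ib : (i <= b)%N by rewrite -ltnS.
rewrite expr1n mulr1 !mulrnAr -mulrnDl -mulrDl -natrD mulrnAr lerMn2r.
apply/orP; right; rewrite [X in _ <= X]mulrCA.
have abm' : (a + i + (b - i))%N = m by lia.
apply: le_trans (ler_wpM2l _ (IHm _ _ abm')); last first.
  by rewrite mulr_ge0 ?exprn_ge0.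
have -> : p ^+ b = p ^+ i * p ^+ (b - i) by rewrite -exprD subnKC.
have Qle : Q <= (1 - p) ^+ (b - i) * (1 - p) ^+ ((a + i) * (b - i) + 'C(b - i, 2)).
  rewrite -exprD /Q; apply: ler_wiXn2l => //.
  rewrite -[in X in (_ <= _ + X)%N](subnKC le_ib) bin2D.
  rewrite -[in X in (_ <= X + _)%N](subnKC le_ib); nia.
set Z := _ ^+ (_ + 'C(b - i, 2)) in Qle *.
set w : R := (a + i)%:R; set M : R := m%:R ^+ (b - i).
have W0 : 0 <= w * M * (p ^+ i * p ^+ (b - i)).
  by rewrite !mulr_ge0 ?exprn_ge0.
have -> : p ^+ i * p ^+ (b - i) * Q * (w * M) =
    w * M * (p ^+ i * p ^+ (b - i)) * Q by ring.
have -> : p ^+ i * (1 - p) ^+ (b - i) * (w * M * (p ^+ (b - i) * Z)) =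
    w * M * (p ^+ i * p ^+ (b - i)) * ((1 - p) ^+ (b - i) * Z) by ring.
exact: ler_wpM2l.
Qed.

Lemma conn_prob_ge (R : realType) (p : R) (s : nat) :
  0 <= p <= 1 -> (0 < s)%N ->
  s%:R ^+ s.-1 * (p ^+ s.-1 * (1 - p) ^+ 'C(s, 2)) <= s%:R * conn_prob p s.
Proof.
case: s => // b p01 _; have := reach_prob_ge p01 (add1n b).
by rewrite /conn_prob mul1r mul1n binS bin1 addnC.
Qed.

(** * Lower bound for the mean number of components *)

(** Each factor 1 - i p of the falling factorial is at least
    (1 - p)^i (1 - i^2 p^2), because (1 - p)^i (1 + i p) <= 1. *)
Lemma ffact_ge (R : realType) (p : R) (n s : nat) :
  0 <= p <= 1 -> n%:R * p = 1 ->
  n%:R ^+ s * (1 - p) ^+ 'C(s, 2) * (1 - s%:R ^+ 3 * p ^+ 2) <= (n ^_ s)%:R.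
Proof.
case/andP=> p0 p1 np; have q0 : 0 <= 1 - p by lra.
have powq t : (1 - p) ^+ t * (1 + t%:R * p) <= 1.
  elim: t => [|t IHt]; first by rewrite expr0; lra.
  apply: le_trans IHt; rewrite exprSr -mulrA ler_wpM2l ?exprn_ge0 // -natr1.
  have : 0 <= t%:R * p ^+ 2 by rewrite mulr_ge0 ?exprn_ge0.
  have := sqr_ge0 p; nra.
elim: s => [|s IHs].
  by rewrite ffactn0 bin0n !expr0 expr0n /=; lra.
have s0 : 0 <= s%:R :> R by [].
have n0 : 0 <= n%:R :> R by [].
have A0 t u : 0 <= n%:R ^+ t * (1 - p) ^+ u :> R by rewrite mulr_ge0 ?exprn_ge0.
have le_cube : s%:R ^+ 3 * p ^+ 2 + s%:R ^+ 2 * p ^+ 2 <= s.+1%:R ^+ 3 * p ^+ 2.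
  rewrite -mulrDl ler_wpM2r ?sqr_ge0 // -natr1.
  have := sqr_ge0 (s%:R : R); nra.
have s2p : 0 <= s%:R ^+ 2 * p ^+ 2 by rewrite mulr_ge0 ?sqr_ge0.
have [neg|pos] := lerP (1 - s%:R ^+ 3 * p ^+ 2) 0.
  apply: (@le_trans _ _ 0) => //; apply: mulr_ge0_le0 => //; lra.
have le_sn : (s <= n)%N.
  rewrite leqNgt; apply/negP => lt_ns.
  have : 1 <= s%:R * p by rewrite -[X in X <= _]np ler_wpM2r // ler_nat ltnW.
  have : 1 <= s%:R :> R by rewrite ler1n; lia.
  move: pos; rewrite exprS; nra.
rewrite ffactnSr natrM natrB //.
have sp1 : s%:R * p <= 1 by rewrite -[X in _ <= X]np ler_wpM2r // ler_nat.
apply: le_trans (ler_wpM2r _ IHs); last by rewrite subr_ge0 ler_nat.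
rewrite binS bin1 exprD exprSr.
have -> : n%:R ^+ s * n%:R * ((1 - p) ^+ 'C(s, 2) * (1 - p) ^+ s) *
    (1 - s.+1%:R ^+ 3 * p ^+ 2) =
  (n%:R ^+ s * (1 - p) ^+ 'C(s, 2)) *
    (n%:R * ((1 - p) ^+ s * (1 - s.+1%:R ^+ 3 * p ^+ 2))) by ring.
rewrite -[X in _ <= X]mulrA ler_wpM2l //.
have -> : (1 - s%:R ^+ 3 * p ^+ 2) * (n%:R - s%:R) =
    n%:R * ((1 - s%:R * p) * (1 - s%:R ^+ 3 * p ^+ 2)).
  transitivity ((1 - s%:R ^+ 3 * p ^+ 2) * (n%:R - s%:R * (n%:R * p))).
    by rewrite np mulr1.
  ring.
rewrite ler_wpM2l //.
have qs0 : 0 <= (1 - p) ^+ s by rewrite exprn_ge0.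
apply: (@le_trans _ _ ((1 - p) ^+ s *
    ((1 - s%:R ^+ 2 * p ^+ 2) * (1 - s%:R ^+ 3 * p ^+ 2)))).
  rewrite ler_wpM2l //.
  have : 0 <= (s%:R ^+ 2 * p ^+ 2) * (s%:R ^+ 3 * p ^+ 2) :> R.
    by rewrite !mulr_ge0 ?exprn_ge0.
  lra.
rewrite mulrA ler_wpM2r //; first exact: ltW.
have := ler_wpM2r (_ : 0 <= 1 - s%:R * p) (powq s); rewrite mul1r => h.
apply: le_trans (h _); last by lra.
by rewrite le_eqVlt; apply/orP; left; apply/eqP; ring.
Qed.

Lemma expr1D_ge3 (R : realType) (y : R) (N : nat) :
  0 <= y -> (1 < N)%N ->
  1 + N%:R * y + N%:R * (N%:R - 1) / 2 * y ^+ 2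
    + N%:R * (N%:R - 1) * (N%:R - 2) / 6 * y ^+ 3 <= (1 + y) ^+ N.
Proof.
move=> y0; case: N => [|[|N]] // _; elim: N => [|N IHN].
  by lra.
have y1 : 0 <= 1 + y by lra.
have := ler_wpM2l y1 IHN; rewrite -exprS; apply: le_trans.
have N0 : 0 <= N%:R :> R by [].
have -> : N.+3%:R = N%:R + 3 :> R by rewrite -addn3 natrD.
have -> : N.+2%:R = N%:R + 2 :> R by rewrite -addn2 natrD.
have : 0 <= (N%:R + 2) * (N%:R + 2 - 1) * (N%:R + 2 - 2) / 6 * y ^+ 4 :> R.
  by rewrite mulr_ge0 ?exprn_ge0 // divr_ge0 // !mulr_ge0 //; lra.
lra.
Qed.

(** Both sides tend to e^2, with an error of relative order 1/s^2; their ratio is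
    therefore within order 1/s^3 of 1, which a quadratic expansion cannot resolve.
    With y = 1 / (s (s + 2)), the ratio of the two bases is 1 + y. *)
Lemma exp_approx_decr (R : realType) (s : nat) :
  (0 < s)%N ->
  (s.+2%:R / s.+1%:R) ^+ (s.*2.+3) <= (s.+1%:R / s%:R) ^+ (s.*2.+1) :> R.
Proof.
move=> s_gt0; have t1 : 1 <= s%:R :> R by rewrite ler1n.
pose t : R := s%:R; pose y := (t * (t + 2))^-1.
have -> : s.+2%:R = t + 2 by rewrite -addn2 natrD.
have -> : s.+1%:R = t + 1 by rewrite -!natr1.
rewrite -/t in t1 *.
have -> : (t + 1) / t = (1 + y) * ((t + 2) / (t + 1)).
  by rewrite /y; field; apply/and3P; split; lra.
have x0 : 0 <= (t + 2) / (t + 1) by rewrite divr_ge0; lra.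
rewrite [X in _ <= X]exprMn -[s.*2.+3]addn2 [X in X <= _]exprD.
rewrite [X in X <= _]mulrC ler_wpM2r ?exprn_ge0 //.
have y0 : 0 <= y by rewrite invr_ge0 mulr_ge0; lra.
apply: le_trans (expr1D_ge3 y0 _); last by lia.
have -> : (s.*2.+1)%:R = 2 * t + 1 :> R by rewrite -addn1 natrD -mul2n natrM.
rewrite -subr_ge0 [X in 0 <= X](_ : _ =
  (t ^+ 4 + 5 * t ^+ 3 + 18 * t ^+ 2 + 16 * t - 1) /
  (3 * t ^+ 2 * (t + 2) ^+ 3 * (t + 1) ^+ 2)).
  apply: divr_ge0.
    have : 1 <= t ^+ 2 by rewrite -[1](expr1n _ 2) ler_sqr ?nnegrE; lra.
    have : 0 <= t ^+ 4 by apply: exprn_ge0; lra.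
    have : 0 <= t ^+ 3 by apply: exprn_ge0; lra.
    lra.
  by rewrite !mulr_ge0 ?exprn_ge0 //; lra.
rewrite /y; field; apply/and3P; split; lra.
Qed.

(** Stirling's bound s! <= C sqrt(s) (s/e)^s, squared, with r = (1 - p)^(n - 1) in
    place of 1/e. The ratio of consecutive right-hand sides dominates that of the
    left-hand sides when (1 + 1/s)^(2 s + 1) r^2 >= 1; this quantity decreases in s
    and at s = n - 1 equals 1 / (1 - p). The same inequality at s = 1 is the base
    case, with the constant 8 = (1 + 1/1)^3. *)
Lemma fact_sqr_le (R : realType) (p : R) (n s : nat) :
  0 <= p < 1 -> n%:R * p = 1 -> (0 < s < n)%N ->
  (s`!)%:R ^+ 2 <= 8 * s%:R * ((s%:R * (1 - p) ^+ n.-1) ^+ s) ^+ 2.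
Proof.
case/andP=> p0 p1; case: n => [|m] np; first by rewrite ltn0 andbF.
rewrite ltnS => /andP[s0 sm]; rewrite [_.-1]/=; set r := (1 - p) ^+ m.
have q0 : 0 < 1 - p by lra.
have m0 : 0 < m%:R :> R by rewrite ltr0n; lia.
have r0 : 0 < r by rewrite exprn_gt0.
pose x (t : nat) : R := t.+1%:R / t%:R.
have x_ge0 t : 0 <= x t by rewrite divr_ge0.
have xr t : (0 < t <= m)%N -> 1 <= x t ^+ t.*2.+1 * r ^+ 2.
  case/andP=> t0 tm; apply: (@le_trans _ _ (x m ^+ m.*2.+1 * r ^+ 2)).
    have -> : x m = (1 - p)^-1.
      have mE : m%:R = m.+1%:R * (1 - p) by rewrite mulrBr np mulr1 -natr1 addrK.
      by rewrite /x mE invfM mulrA divff ?mul1r // pnatr_eq0.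
    rewrite /r -exprM muln2 exprS exprVn -mulrA mulVf ?mulr1; last first.
      by rewrite expf_neq0 ?lt0r_neq0.
    by rewrite invf_ge1 //; lra.
  rewrite ler_wpM2r ?sqr_ge0 //.
  rewrite -(subnKC tm); elim: (m - t)%N => [|k IHk]; first by rewrite addn0.
  apply: le_trans IHk; rewrite addnS doubleS; apply: exp_approx_decr; lia.
elim: s s0 sm => // -[_ _ m1|s IHs _ sm].
  have := xr 1%N m1; have -> : x 1%N ^+ 1.*2.+1 = 8 by rewrite /x divr1 -natrX.
  by rewrite !mul1r mulr1 expr1 expr1n.
have t0 : 0 < s.+1%:R :> R by rewrite ltr0n.
have {}IHs := IHs isT (ltnW sm).
have := xr s.+1 (ltnW sm); rewrite /x; clear x x_ge0 xr => h.
rewrite factS natrM; set a : R := s.+1%:R in t0 IHs h *.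
set b : R := s.+2%:R in h *; have b0 : 0 <= b by [].
have {}h : a ^+ s.+1.*2.+1 <= b ^+ s.+1.*2.+1 * r ^+ 2.
  by move: h; rewrite expr_div_n mulrAC ler_pdivlMr ?exprn_gt0 // mul1r.
have C0 : 0 <= 8 * b ^+ 2 * (r ^+ s.+1) ^+ 2.
  by do 2![apply: mulr_ge0; rewrite ?sqr_ge0 //].
rewrite exprMn; apply: le_trans (ler_wpM2l (sqr_ge0 b) IHs) _.
have -> : b ^+ 2 * (8 * a * ((a * r) ^+ s.+1) ^+ 2) =
    8 * b ^+ 2 * (r ^+ s.+1) ^+ 2 * a ^+ s.+1.*2.+1.
  by rewrite [a ^+ _.*2.+1]exprS -muln2 exprM [(a * r) ^+ _]exprMn; ring.
have -> : 8 * b * ((b * r) ^+ s.+2) ^+ 2 =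
    8 * b ^+ 2 * (r ^+ s.+1) ^+ 2 * (b ^+ s.+1.*2.+1 * r ^+ 2).
  rewrite [b ^+ _.*2.+1]exprS -muln2 exprM [(b * r) ^+ _]exprS.
  by rewrite [(b * r) ^+ _]exprMn; ring.
exact: ler_wpM2l.
Qed.

(** The powers of 1 - p in the binomial coefficient, in the probability of
    connectedness and in the cut add up to the exponent s (n - 1), so that
    s! s^2 mean_comp n p s >= n (1 - s^3 p^2) (s r)^s; Stirling's bound removes
    the factor (s r)^s. *)
Lemma mean_comp_ge (R : realType) (p : R) (n k s : nat) :
  0 <= p < 1 -> n%:R * p = 1 -> (0 < s < n)%N -> (s <= k.*2)%N ->
  n%:R * (1 - s%:R ^+ 3 * p ^+ 2) <=
  16 * k%:R ^+ 2 * Num.sqrt k%:R * mean_comp n p s.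
Proof.
move=> p01' np s0n sk; have /andP[s0 sn] := s0n; have /andP[p0 p1] := p01'.
have p01 : 0 <= p <= 1 by rewrite p0 ltW.
have q0 : 0 < 1 - p by lra.
set r := (1 - p) ^+ n.-1; set srs := (s%:R * r) ^+ s.
have sR : 0 < s%:R :> R by rewrite ltr0n.
have srs0 : 0 < srs by rewrite exprn_gt0 // mulr_gt0 // exprn_gt0.
have mean0 : 0 <= mean_comp n p s.
  by rewrite mulrn_wge0 ?mulr_ge0 ?conn_prob_ge0 ?exprn_ge0 // ltW.
have skR : s%:R <= 2 * k%:R :> R by rewrite -natrM ler_nat mul2n.
have fact_le : (s`!)%:R <= 4 * Num.sqrt k%:R * srs :> R.
  rewrite -ler_sqr ?nnegrE ?mulr_ge0 ?sqrtr_ge0 //; last exact: ltW.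
  apply: le_trans (fact_sqr_le p01' np s0n) _.
  rewrite !exprMn sqr_sqrtr // -!exprMn -/r -/srs ler_wpM2r ?sqr_ge0 //; lra.
have key : n%:R * (1 - s%:R ^+ 3 * p ^+ 2) * srs <=
    (s`!)%:R * s%:R ^+ 2 * mean_comp n p s.
  have -> : (s`!)%:R * s%:R ^+ 2 * mean_comp n p s =
      (n ^_ s)%:R * (s%:R * (1 - p) ^+ (s * (n - s)) * (s%:R * conn_prob p s)).
    rewrite -bin_ffact natrM /mean_comp -[_ *+ 'C(n, s)]mulr_natr; ring.
  have w0 : 0 <= s%:R * (1 - p) ^+ (s * (n - s)).
    by rewrite mulr_ge0 ?exprn_ge0 // ltW.
  have f0 : 0 <= (n ^_ s)%:R :> R by [].
  apply: le_trans (ler_wpM2l f0 (ler_wpM2l w0 (conn_prob_ge p01 s0))).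
  set W := (X in _ <= _ * X).
  have W0 : 0 <= W by rewrite /W !mulr_ge0 ?exprn_ge0 // ltW.
  apply: le_trans (ler_wpM2r W0 (ffact_ge s p01 np)).
  rewrite le_eqVlt; apply/orP; left; apply/eqP.
  rewrite [RHS]mulrAC [LHS]mulrAC; congr (_ * _).
  rewrite /W /srs /r exprMn -exprM.
  have -> : (n.-1 * s = 'C(s, 2) + (s * (n - s) + 'C(s, 2)))%N.
    have := mul_bin_diag s 1; rewrite bin1; nia.
  have ss : s%:R ^+ s = s%:R * s%:R ^+ s.-1 :> R by rewrite -exprS prednK.
  have ns : n%:R ^+ s * p ^+ s.-1 = n%:R.
    by rewrite -{1}(prednK s0) exprS -mulrA -exprMn np expr1n mulr1.
  by rewrite !exprD ss -[in LHS]ns; ring.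
rewrite -(ler_pM2r srs0); apply: le_trans key _.
have s2 : s%:R ^+ 2 <= 4 * k%:R ^+ 2 :> R.
  have : 0 <= k%:R :> R by []. nra.
have A : (s`!)%:R * s%:R ^+ 2 <= (4 * Num.sqrt k%:R * srs) * (4 * k%:R ^+ 2).
  by rewrite ler_pM ?sqr_ge0.
have -> : 16 * k%:R ^+ 2 * Num.sqrt k%:R * mean_comp n p s * srs =
    (4 * Num.sqrt k%:R * srs) * (4 * k%:R ^+ 2) * mean_comp n p s by ring.
exact: ler_wpM2r.
Qed.

(** * The probability of having only small components *)

Lemma Gnp_probE (R : realType) (n : nat) (p : R) (A : pred (graph n)) :
  Gnp_prob p A = expect p (fun G => (A G)%:R).
Proof.
rewrite /Gnp_prob /expect big_mkcond; apply: eq_bigr => G _.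
by case: (A G); rewrite ?mulr1 ?mulr0.
Qed.

Lemma ler_Gnp_prob (R : realType) (n : nat) (p : R) (A B : pred (graph n)) :
  0 <= p <= 1 -> (forall G, A G -> B G) -> Gnp_prob p A <= Gnp_prob p B.
Proof.
move=> p01 AB; rewrite !Gnp_probE; apply: ler_expect => // G.
by case AG: (A G); rewrite ?ler0n // AB.
Qed.

(** Up to constants, P <= k^(3/2) / n. The hypothesis keeps s^3 / n^2 below 1/15 for
    s <= 2k, and each of the k + 1 sizes between k and 2k contributes at least
    a constant times n k^(-5/2) to the mean. *)
Lemma largest_component_lt_bound (R : realType) (n k : nat) :
  (0 < k)%N -> (125 * k ^ 3 <= n ^ 2)%N ->
  14 * n%:R * Gnp_prob (n%:R^-1 : R) (fun G : graph n => (largest_component_size G < k)%N)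
   <= 240 * (k%:R * Num.sqrt k%:R).
Proof.
move=> k0 kn; have k2n : (k.*2 < n)%N by nia.
have n1 : (1 < n)%N by lia.
set p : R := n%:R^-1.
have nR : 1 < n%:R :> R by rewrite ltr1n.
have np : n%:R * p = 1 by rewrite mulfV //; lra.
have p0 : 0 <= p by rewrite invr_ge0.
have p1 : p < 1 by rewrite invf_lt1; lra.
have p01 : 0 <= p <= 1 by rewrite p0 ltW.
have kR : 0 < k%:R :> R by rewrite ltr0n.
have sq0 : 0 < Num.sqrt k%:R :> R by rewrite sqrtr_gt0.
set P := Gnp_prob _ _.
pose V s := (k <= s <= k.*2)%N.
set mu := \sum_(s < n.+1 | V s) mean_comp n p s.
have P0 : 0 <= P by rewrite /P Gnp_probE; apply: expect_ge0 => // G.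
have mean0 s : 0 <= mean_comp n p s.
  by rewrite mulrn_wge0 ?mulr_ge0 ?conn_prob_ge0 ?exprn_ge0 // subr_ge0 ltW.
have mu0 : 0 <= mu by apply: sumr_ge0.
have Pmu : P * mu <= 1.
  have V0 : ~~ V 0%N by rewrite /V; lia.
  apply: le_trans (no_component_bound p0 _ (ltnW n1) V0); last by rewrite np.
  rewrite ler_wpM2r // -Gnp_probE; apply: ler_Gnp_prob => // G small.
  apply/forall_inP => S /andP[kS _]; apply: contraTN small => SG.
  by rewrite -leqNgt; rewrite /largest_component_size; exact: bigop.bigmax_sup SG kS.
have np2 : n%:R ^+ 2 * p ^+ 2 = 1 :> R by rewrite -exprMn np expr1n.
have mu_ge : n%:R * (14 / 15) <= 16 * (k%:R * Num.sqrt k%:R) * mu.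
  have term s : V s -> n%:R * (14 / 15) <=
      16 * k%:R ^+ 2 * Num.sqrt k%:R * mean_comp n p s.
    case/andP=> ks sk; apply: le_trans (mean_comp_ge _ np _ sk); last 2 first.
    - by rewrite p0.
    - by apply/andP; split; lia.
    rewrite ler_wpM2l //.
    have : (15 * s ^ 3 <= n ^ 2)%N.
      have : (s ^ 3 <= k.*2 ^ 3)%N by rewrite leq_exp2r.
      rewrite -mul2n expnMn (_ : 2 ^ 3 = 8)%N //; move: kn.
      move: (s ^ 3)%N (k ^ 3)%N (n ^ 2)%N => *; lia.
    rewrite -(ler_nat R) natrM !natrX => h.
    have := ler_wpM2r (sqr_ge0 p) h; rewrite np2; lra.
  rewrite -(ler_pM2r kR).
  apply: (@le_trans _ _ (\sum_(s < n.+1 | V s) n%:R * (14 / 15))).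
    (* The sizes k + i with i < k already suffice. *)
    rewrite sumr_const -[X in _ <= X]mulr_natr; apply: ler_wpM2l; first by lra.
    rewrite ler_nat.
    have lt_n (i : 'I_k) : (k + i < n.+1)%N by have := ltn_ord i; lia.
    pose f (i : 'I_k) : 'I_n.+1 := Ordinal (lt_n i).
    have injf : injective f by move=> i j /(congr1 val) /= /addnI/val_inj.
    rewrite -[k in (k <= _)%N]card_ord -(card_imset _ injf) subset_leq_card //.
    apply/subsetP => _ /imsetP[i _ ->]; rewrite unfold_in /V /=.
    by have := ltn_ord i; lia.
  apply: (@le_trans _ _ (\sum_(s < n.+1 | V s)
      16 * k%:R ^+ 2 * Num.sqrt k%:R * mean_comp n p s)).
    by apply: ler_sum => s; apply: term.
  rewrite -mulr_sumr -/mu le_eqVlt; apply/orP; left; apply/eqP; ring.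
have := ler_wpM2l P0 mu_ge.
have K0 : 0 <= 16 * (k%:R * Num.sqrt k%:R) :> R by rewrite !mulr_ge0 // ltW.
have := ler_wpM2l K0 Pmu; lra.
Qed.

Theorem theorem2 (R : realType) (delta : R) (n : nat)
    (delta_gt0 : 0 < delta) (delta_lt : delta < 1 / 10)
    (n_large : 200 / delta `^ (3 / 5) < n%:R) :
  Gnp_prob (1 / n%:R : R)
    (fun G : graph n =>
       (largest_component_size G)%:Z
         < Num.floor (delta * n%:R `^ (2 / 3)))
    <= 15 * delta `^ (3 / 5).
Proof.
set d35 := delta `^ (3 / 5); set y := n%:R `^ (2 / 3).
have d35_0 : 0 < d35 by rewrite powR_gt0.
have y0 : 0 <= y by rewrite powR_ge0.
have d_le : delta <= d35.
  rewrite -[X in X <= _](powRr1 (ltW delta_gt0)); apply: ger_powR; last by lra.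
  by rewrite delta_gt0; lra.
have y3 : y ^+ 3 = n%:R ^+ 2.
  rewrite -powR_mulrn // -powRrM -powR_mulrn //; congr (_ `^ _); by field.
have nR : 1 <= n%:R :> R.
  rewrite ler1n -(ltr0n R); apply: lt_trans n_large; exact: divr_gt0.
rewrite div1r; case: (lerP 1 (Num.floor (delta * y))) => [fl|fl]; last first.
  rewrite /Gnp_prob big_pred0; first by rewrite mulr_ge0 // ltW.
  by move=> G; lia.
case defk : (Num.floor (delta * y)) fl => [k|//] k0.
have kle : k%:R <= delta * y.
  have : (Num.floor (delta * y))%:~R <= delta * y by exact: Num.Theory.floor_le.
  by rewrite defk.
have k3 : k%:R ^+ 3 <= delta ^+ 3 * n%:R ^+ 2.
  by rewrite -y3 -exprMn ler_pXn2r // nnegrE // mulr_ge0 // ltW.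
have d3 : delta ^+ 3 <= delta ^+ 2 / 10 by rewrite exprSr ler_wpM2l ?sqr_ge0; lra.
have d2 : delta ^+ 2 <= 1 / 100 by nra.
have n2 : 0 <= n%:R ^+ 2 :> R by rewrite sqr_ge0.
have kn : (125 * k ^ 3 <= n ^ 2)%N.
  by rewrite -(ler_nat R) natrM !natrX; nra.
have := @largest_component_lt_bound R n k k0 kn.
set Q := Gnp_prob _ _ => bound.
(* Squaring, this is k^3 <= delta^3 n^2 together with delta < 1/9. *)
have kk : k%:R * Num.sqrt k%:R <= n%:R * (delta / 3) :> R.
  have dn : 0 <= n%:R * (delta / 3) by apply: mulr_ge0 => //; lra.
  rewrite -ler_sqr ?nnegrE //; last by rewrite mulr_ge0 ?sqrtr_ge0.
  rewrite !exprMn sqr_sqrtr // -exprSr; apply: le_trans k3 _.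
  nra.
have : n%:R * (14 * Q) <= n%:R * (14 * (15 * d35)).
  apply: (@le_trans _ _ (240 * (n%:R * (delta / 3)))); first by lra.
  have := ler_wpM2l (ler0n R n) d_le; nra.
rewrite ler_pM2l; lra.
Qed.
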